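(* Let $d\ge 1$ and $r\ge 1$ be integers and let $f$ be a real-valued trigonometric polynomial on $[0,1]^d$ with $\hat f(\omega)=0$ whenever $\|\omega\|_\infty>2r$. Let $\bar f=\hat f(0)$ be its mean value and $f_\ast=\min_{x\in[0,1]^d}f(x)$. Then for every integer $s\ge 3r$, \[ 0\le f_\ast-c_\ast(f,s)\le \|f-\bar f\|_{\rm F}\Big[\Big(1-\frac{6r^2}{s^2}\Big)^{-d}-1\Big], \] and the right-hand side is equivalent to $\|f-\bar f\|_{\rm F}\cdot\frac{6r^2d}{s^2}$ as $s\to+\infty$ with $r,d,f$ fixed.
   Context: Functions on $[0,1]^d$ are identified with $1$-periodic functions on $\mathbb R^d$. Fourier coefficients: $\hat f(\omega)=\int_{[0,1]^d}f(x)e^{-2i\pi\omega^\top x}\,dx$ for $\omega\in\mathbb Z^d$. The F-norm is $\|f\|_{\rm F}=\sum_{\omega\in\mathbb Z^d}|\hat f(\omega)|$. A (complex) trigonometric polynomial of degree at most $s$ is a function $q(x)=\sum_{\omega\in\mathbb Z^d,\|\omega\|_\infty\le s}a_\omega e^{2i\pi\omega^\top x}$ with $a_\omega\in\mathbb C$. For a real-valued trigonometric polynomial $f$ and an integer $s\ge1$, $c_\ast(f,s)$ denotes the supremum of all $c\in\mathbb R$ such that $f-c=\sum_{j=1}^N|q_j|^2$ on $[0,1]^d$ for some finite family of trigonometric polynomials $q_j$ of degree at most $s$ (the value of the degree-$s$ sum-of-squares relaxation). *)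

(* Defs.v *)
From HB Require Import structures.
From mathcomp Require Import all_boot all_order all_algebra.
From mathcomp Require Import all_classical all_reals all_analysis.
From mathcomp Require complex.
Import complex.ComplexField.
Set Implicit Arguments. Unset Strict Implicit. Unset Printing Implicit Defensive.
Import Order.TTheory GRing.Theory Num.Theory.
Import numFieldNormedType.Exports.
Local Open Scope classical_set_scope.
Local Open Scope ring_scope.

Notation "R [i]" := (complex.complex R) (format "R [i]").
Notation Re := complex.Re.
Notation Im := complex.Im.
Notation cmod := Normc.normc.

(* Frequencies w in Z^d with ||w||_oo <= n, encoded as k : 'I_d -> 'I_(2n+1),
   w_i = k_i - n. *)
Definition freq (d n : nat) := {ffun 'I_d -> 'I_(n.*2.+1)}.

Definition fval (d n : nat) (k : freq d n) (i : 'I_d) : int := (k i)%:Z - n%:Z.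

Definition freq0 (d n : nat) : freq d n := [ffun _ => inord n].

Definition echar (R : realType) (d n : nat) (k : freq d n) (x : 'I_d -> R) : R[i] :=
  let t := 2 * pi * \sum_(i < d) (fval k i)%:~R * x i in
  complex.Complex (cos t) (sin t).

Definition trigpol (R : realType) (d n : nat) (a : freq d n -> R[i])
  (x : 'I_d -> R) : R[i] :=
  \sum_(k : freq d n) a k * echar k x.

Definition cube (R : realType) (d : nat) : set ('I_d -> R) :=
  [set x | forall i, 0 <= x i <= 1].
Arguments cube : clear implicits.

Definition meanval (R : realType) (d n : nat) (a : freq d n -> R[i]) : R[i] :=
  a (freq0 d n).

Definition Fnorm_centered (R : realType) (d n : nat) (a : freq d n -> R[i]) : R :=
  \sum_(k : freq d n | k != freq0 d n) cmod (a k).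

(* f_* = min_{x in [0,1]^d} f(x)  (written as an infimum; it is attained) *)
Definition fstar (R : realType) (d n : nat) (a : freq d n -> R[i]) : R :=
  inf [set Re (trigpol a x) | x in cube R d].

Definition sos_bounds (R : realType) (d n : nat) (a : freq d n -> R[i]) (s : nat)
  : set R :=
  [set c : R | exists (N : nat) (b : 'I_N -> freq d s -> R[i]),
     forall x, cube R d x ->
       trigpol a x - complex.Complex c 0 = \sum_(j < N) `|trigpol (b j) x| ^+ 2].

Definition cstar (R : realType) (d n : nat) (a : freq d n -> R[i]) (s : nat)
  : \bar R :=
  ereal_sup [set c%:E | c in sos_bounds a s].

Definition sos_bound (R : realType) (d n r s : nat) (a : freq d n -> R[i]) : R :=
  Fnorm_centered a * ((1 - 6 * (r%:R) ^+ 2 / (s%:R) ^+ 2) ^- d - 1).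

(* Main.v *)
Require Import Defs.
From HB Require Import structures.
From mathcomp Require Import all_boot all_order all_algebra.
From mathcomp Require Import all_classical all_reals all_analysis.
From mathcomp Require complex.
From mathcomp Require Import ring lra zify.
Import -(notations) complex.
Import complex.ComplexField.
Import Order.TTheory GRing.Theory Num.Theory.
Import numFieldNormedType.Exports.
Local Open Scope classical_set_scope.
Local Open Scope ring_scope.

(** Lower bounds on [c_*] come from convolution with a nonnegative kernel.
    Let [q] be the one-variable trigonometric polynomial of degree [s] whose
    coefficients are the tent [s - |j|], and let [K] be the product of the
    [|q(x_i)|^2], normalised to have mean [1].  Convolution with [K] multiplies
    the coefficient at [w] by [lam w], the product over [i] of the normalised
    autocorrelations of the tent at [w_i].  If [h] is obtained from [f] by
    dividing its coefficients by [lam], then [f - c] is the convolution of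
    [h - c] with [K]; when [c <= h] this is a sum of squares of degree [s],
    because the convolution is computed exactly by a quadrature on a regular
    grid with more than [2 s + 2 r] points per axis.

    Taking real parts in that identity makes Hermitian symmetry of the
    coefficients unnecessary: [K] is real, so [h] may be replaced by [Re h].

    The distance between [h] and [f] is at most [||f - mean||_F] times the
    maximum of [1 / lam - 1], so it remains to bound [lam] from below.  The
    defect [1 - lam k] in one variable is half the squared norm of the
    difference between the normalised tent and its shift by [k], which is at
    most [k^2] times its value at [k = 1]; this gives [3 k^2 / (2 s^2)], that
    is [6 r^2 / s^2] when [k = 2 r]. *)

(** * Autocorrelation of the tent *)

Section Autocorrelation.
Context {R : realFieldType}.
Implicit Types (p g : nat -> R) (k n : nat).

Lemma sum_shiftr g k n : g 0 = 0 ->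
  \sum_(0 <= i < n) g (i - k)%N = \sum_(0 <= i < n - k) g i.
Proof.
move=> g0; have [kn|nk] := leqP k n; last first.
  rewrite [RHS]big_geq; last by lia.
  rewrite big1_seq // => i; rewrite mem_index_iota => /andP[_ /andP[_ ?]];
     rewrite (_ : (i - k)%N = 0) //; lia.
rewrite (big_cat_nat (leq0n k) kn) /= big1_seq ?add0r; last first.
  by move=> i; rewrite mem_index_iota => /andP[_ /andP[_ ?]];
     rewrite (_ : (i - k)%N = 0) //; lia.
rewrite -{1}[k]add0n big_addn; apply: eq_bigr => i _; by rewrite addnK.
Qed.

(* The truncated subtraction is harmless, as [p 0 = 0] in all applications. *)
Definition autocorr p n k : R := \sum_(0 <= i < n) p i * p (i - k)%N.

(** This is the triangle inequality in squared form: a shift by [k] is a chain of [k] unit shifts,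
    and each link has energy at most that of the first. *)
Lemma shift_energy_le p k n :
  \sum_(0 <= i < n) (p i - p (i - k)%N) ^+ 2 <=
  k%:R ^+ 2 * \sum_(0 <= i < n) (p i - p i.-1) ^+ 2.
Proof.
elim: k => [|k IH].
  rewrite expr0n /= mul0r big1 // => i _; by rewrite subn0 subrr expr0n.
(* The case [k = 0] is treated apart because the inequality is multiplied by [k] below. *)
have [->|k0] := posnP k.
  by rewrite expr1n mul1r; under eq_bigr do rewrite subn1.
set D := \sum_(_ <= _ < _) (p _ - p _.-1) ^+ 2 in IH *.
have shift : \sum_(0 <= i < n) (p (i - k)%N - p (i - k.+1)%N) ^+ 2 <= D.
  under eq_bigr do rewrite subnS.
  rewrite (sum_shiftr (fun i => (p i - p i.-1) ^+ 2)) ?subrr ?expr0n // /D.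
  rewrite (big_cat_nat (leq0n (n - k)) (leq_subr k n)) /= lerDl.
  by apply: sumr_ge0 => i _; exact: sqr_ge0.
have kR : 0 < k%:R :> R by rewrite ltr0n.
rewrite -(ler_pM2l kR) mulr_sumr.
(* [k (x + y)^2 <= (k + 1) x^2 + k (k + 1) y^2], as [(x - k y)^2 >= 0] *)
apply: (@le_trans _ _ (\sum_(0 <= i < n)
   (k.+1%:R * (p i - p (i - k)%N) ^+ 2 +
    k%:R * k.+1%:R * (p (i - k)%N - p (i - k.+1)%N) ^+ 2))).
  apply: ler_sum => i _; rewrite -natr1 -subr_ge0.
  set x := p i; set y := p (i - k)%N; set z := p (i - k.+1)%N.
  rewrite (_ : _ - _ = ((x - y) - k%:R * (y - z)) ^+ 2) ?sqr_ge0 //; ring.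
rewrite big_split /= -!mulr_sumr -natr1.
apply: (@le_trans _ _ ((k%:R + 1) * (k%:R ^+ 2 * D) + k%:R * (k%:R + 1) * D)).
  by rewrite lerD // ler_wpM2l ?mulr_ge0 ?addr_ge0 ?ler0n ?ler01.
by rewrite le_eqVlt; apply/orP; left; apply/eqP; ring.
Qed.

(** The left side is the coefficient at [w] of the squared modulus of a polynomial with coefficients
    [p]. Exchanging [j] and [l] reduces negative [w] to positive. *)
Lemma autocorr_pairs p n (w : int) : p 0 = 0 ->
  \sum_(j < n) \sum_(l < n) p j * p l *+ (j%:Z - l%:Z == w) = autocorr p n `|w|.
Proof.
move=> p0.
have pos k : \sum_(j < n) \sum_(l < n) p j * p l *+ (j%:Z - l%:Z == k%:Z) =
    autocorr p n k.
  rewrite /autocorr big_mkord; apply: eq_bigr => j _.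
  have [kj|jk] := leqP k j; last first.
    rewrite (_ : (j - k)%N = 0); last by lia.
    rewrite p0 mulr0 big1 // => l _; rewrite (_ : (_ == _) = false) ?mulr0n //.
    by apply/eqP; lia.
  have jn : (j - k < n)%N by have := ltn_ord j; lia.
  rewrite (bigD1 (Ordinal jn)) //= big1 ?addr0 => [|l lj].
    by rewrite (_ : (_ == _) = true) ?mulr1n //; apply/eqP; lia.
  rewrite (_ : (_ == _) = false) ?mulr0n //; apply/eqP => e; case/eqP: lj.
  by apply: val_inj => /=; lia.
case: w => k; first exact: pos.
rewrite -pos exchange_big; apply: eq_bigr => j _; apply: eq_bigr => l _ /=.
rewrite [p l * _]mulrC; congr (_ *+ nat_of_bool _); apply/eqP/eqP; lia.
Qed.

(** Expand the square. The range [n + k] is long enough to hold the whole shifted copy, so both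
    square terms sum to [autocorr p n 0]. *)
Lemma autocorr_energy p k n : p 0 = 0 -> (forall i, (n <= i)%N -> p i = 0) ->
  \sum_(0 <= i < n + k) (p i - p (i - k)%N) ^+ 2 =
  2 * (autocorr p n 0 - autocorr p n k).
Proof.
move=> p0 pn.
have trunc (F : nat -> R) : (forall i, (n <= i)%N -> F i = 0) ->
    \sum_(0 <= i < n + k) F i = \sum_(0 <= i < n) F i.
  move=> F0; rewrite (big_cat_nat (leq0n n) (leq_addr k n)) /=.
  rewrite [X in _ + X]big1_seq ?addr0 // => i.
  by rewrite mem_index_iota => /andP[_ /andP[? _]]; exact: F0.
have -> : \sum_(0 <= i < n + k) (p i - p (i - k)%N) ^+ 2 =
   \sum_(0 <= i < n + k) p i ^+ 2 + \sum_(0 <= i < n + k) p (i - k)%N ^+ 2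
   - 2 * \sum_(0 <= i < n + k) p i * p (i - k)%N.
  rewrite mulr_sumr -sumrN -!big_split /=; apply: eq_bigr => i _; ring.
rewrite (sum_shiftr (fun i => p i ^+ 2)) ?p0 ?expr0n // addnK.
rewrite !trunc => [|i ni|i ni]; [|by rewrite pn ?mul0r|by rewrite pn ?expr0n].
rewrite /autocorr; under [in RHS]eq_bigr do rewrite subn0 -expr2.
ring.
Qed.

Lemma autocorr_le p k n : p 0 = 0 -> (forall i, (n <= i)%N -> p i = 0) ->
  autocorr p n k <= autocorr p n 0.
Proof.
move=> p0 pn; rewrite -subr_ge0 -(pmulr_rge0 _ (ltr0Sn R 1)).
rewrite -autocorr_energy //; apply: sumr_ge0 => i _; exact: sqr_ge0.
Qed.

(* The weight [s - |j|] at frequency [j = i - s], for [i <= 2 s]. *)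
Definition tent (s i : nat) : R := (minn i (s.*2 - i))%:R.

Lemma tent0 s : tent s 0 = 0. Proof. by rewrite /tent min0n. Qed.

Lemma tent_out s i : (s.*2.+1 <= i)%N -> tent s i = 0.
Proof. by move=> h; rewrite /tent (_ : minn _ _ = 0) //; lia. Qed.

(** The tent has slope 1 or -1 on each of its [2 s] unit steps and is flat elsewhere. *)
Lemma tent_energy s k :
  \sum_(0 <= i < s.*2.+1 + k) (tent s i - tent s i.-1) ^+ 2 = 2 * s%:R.
Proof.
rewrite addSn big_nat_recl // subrr expr0n add0r /=.
rewrite (big_cat_nat (leq0n s.*2) (leq_addr k _)) /=.
rewrite [X in _ + X]big1_seq ?addr0; last first.
  move=> i; rewrite mem_index_iota => /andP[_ /andP[? _]].
  have e1 : minn i.+1 (s.*2 - i.+1) = 0 by lia.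
  have e2 : minn i (s.*2 - i) = 0 by lia.
  by rewrite /tent e1 e2 subrr expr0n.
rewrite (eq_big_nat _ _ (F2 := fun=> 1)); last first.
  move=> i /andP[_ hi]; rewrite /tent.
  have [h|h] := leqP i.+1 s.
    rewrite (_ : minn i.+1 _ = (minn i (s.*2 - i)).+1); last by lia.
    by rewrite -natr1 addrAC subrr add0r expr1n.
  rewrite (_ : minn i _ = (minn i.+1 (s.*2 - i.+1)).+1); last by lia.
  by rewrite -natr1 opprD addrA subrr add0r sqrrN expr1n.
by rewrite sumr_const_nat subn0 -mul2n natrM.
Qed.

(** The rising half with the peak and the mirrored falling half are two sums of consecutive squares,
    evaluated by [sq]. *)
Lemma tent_norm s : 3 * autocorr (tent s) s.*2.+1 0 = 2 * s%:R ^+ 3 + s%:R.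
Proof.
have sq n : 6 * \sum_(0 <= i < n) i%:R ^+ 2 =
    n%:R * (n%:R - 1) * (2 * n%:R - 1) :> R.
  elim: n => [|n IH]; first by rewrite big_geq // mulr0 mul0r mul0r.
  by rewrite big_nat_recr //= mulrDr IH -natr1; ring.
rewrite /autocorr; under eq_bigr do rewrite subn0 -expr2.
rewrite (big_cat_nat (leq0n s.+1)) /=; last by lia.
rewrite (eq_big_nat _ _ (F2 := fun i => i%:R ^+ 2)); last first.
  by move=> i ?; rewrite /tent (_ : minn _ _ = i) //; lia.
have -> : \sum_(s.+1 <= i < s.*2.+1) tent s i ^+ 2 =
    \sum_(0 <= i < s) i%:R ^+ 2.
  rewrite -{1}[s.+1]add0n big_addn (_ : (s.*2.+1 - s.+1)%N = s); last by lia.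
  rewrite big_nat_rev /=; apply: eq_big_nat => i ?.
  by rewrite /tent (_ : minn _ _ = i) //; lia.
have h1 := sq s.+1; have h2 := sq s; rewrite -natr1 in h1; lra.
Qed.

Lemma tent_norm_gt0 s : (0 < s)%N -> 0 < autocorr (tent s) s.*2.+1 0.
Proof.
move=> s0; rewrite -(pmulr_rgt0 _ (ltr0Sn R 2)) tent_norm.
have : 0 < s%:R :> R by rewrite ltr0n.
by move=> h; rewrite addr_gt0 // mulr_gt0 // exprn_gt0.
Qed.

(** With [S] the autocorrelation at 0, the defect is half the shift energy over [S], hence at most
    [k^2 s / S]; then [3 S = 2 s^3 + s >= 2 s^3]. *)
Lemma tent_autocorr_ge s k : (0 < s)%N ->
  1 - 3 * k%:R ^+ 2 / (2 * s%:R ^+ 2) <=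
  autocorr (tent s) s.*2.+1 k / autocorr (tent s) s.*2.+1 0.
Proof.
move=> s0; have sR : 0 < s%:R :> R by rewrite ltr0n.
have S0 := tent_norm_gt0 s s0.
have e := autocorr_energy (tent s) k s.*2.+1 (tent0 s) (tent_out s).
have := shift_energy_le (tent s) k (s.*2.+1 + k).
rewrite e tent_energy => h.
have := tent_norm s; rewrite ler_pdivlMr //.
set S := autocorr _ _ 0 in S0 h *; set L := autocorr _ _ k in h * => hS.
have h2 : k%:R ^+ 2 * s%:R <= 3 * k%:R ^+ 2 / (2 * s%:R ^+ 2) * S.
  rewrite [leRHS]mulrAC ler_pdivlMr; last by rewrite mulr_gt0 // exprn_gt0.
  rewrite (_ : 3 * _ * S = k%:R ^+ 2 * (3 * S)); last by ring.
  rewrite hS.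
  rewrite -subr_ge0 (_ : _ - _ = k%:R ^+ 2 * s%:R); last by ring.
  by rewrite mulr_ge0 ?sqr_ge0 // ltW.
rewrite mulrBl mul1r lerBlDr; apply: (@le_trans _ _ (L + k%:R ^+ 2 * s%:R)).
  lra.
by rewrite lerD2l.
Qed.

End Autocorrelation.

(** * Exponentials *)

Section Cis.
Context {R : realType}.
Implicit Types t : R.

Definition cis t : R[i] :=
  complex.Complex (cos (2 * pi * t)) (sin (2 * pi * t)).

Lemma cisD t u : cis (t + u) = cis t * cis u.
Proof.
rewrite /cis mulrDr cosD sinD.
by rewrite [RHS]/GRing.mul /= [X in complex.Complex _ X]addrC.
Qed.

Lemma cis0 : cis 0 = 1.
Proof. by rewrite /cis mulr0 cos0 sin0. Qed.

Lemma cis_conj t : complex.conjc (cis t) = cis (- t).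
Proof. by rewrite /cis mulrN cosN sinN. Qed.

Lemma cis_sum (I : Type) (r : seq I) (P : pred I) (F : I -> R) :
  cis (\sum_(i <- r | P i) F i) = \prod_(i <- r | P i) cis (F i).
Proof. exact: (big_morph _ cisD cis0). Qed.

Lemma cisMn t n : cis (n%:R * t) = cis t ^+ n.
Proof.
elim: n => [|n IH]; first by rewrite mul0r cis0 expr0.
by rewrite -natr1 mulrDl mul1r cisD IH exprSr.
Qed.

Lemma cis_nat n : cis n%:R = 1.
Proof.
rewrite -[n%:R]mulr1 cisMn (_ : cis 1 = 1) ?expr1n //.
by rewrite /cis mulr1 mulrC mulr_natr cos2pi sin2pi.
Qed.

(** The real part is [1 - 2 sin^2 (pi t)], and the sine is positive on the open interval. *)
Lemma cis_neq1 t : 0 < t < 1 -> cis t != 1.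
Proof.
move=> /andP[t0 t1]; apply/negP => /eqP [+ _].
have -> : 2 * pi * t = (pi * t) *+ 2 by rewrite mulr2n; ring.
rewrite cos_mulr2n.
have : 0 < sin (pi * t).
  by apply: sin_gt0_pi; rewrite mulr_gt0 ?pi_gt0 //= gtr_pMr ?pi_gt0.
have := cos2Dsin2 (pi * t); rewrite mulr2n; nra.
Qed.

Lemma sum_cis_grid_nat (M k : nat) : (0 < k < M)%N ->
  \sum_(m < M) cis (k%:R * (m%:R / M%:R)) = 0.
Proof.
move=> /andP[k0 kM]; have M0 : 0 < M%:R :> R by rewrite ltr0n (leq_trans _ kM).
pose z := cis (k%:R / M%:R).
have -> : \sum_(m < M) cis (k%:R * (m%:R / M%:R)) = \sum_(m < M) z ^+ m.
  by apply: eq_bigr => m _; rewrite -cisMn mulrCA.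
have : z ^+ M - 1 = 0.
  by rewrite -cisMn mulrC divfK ?gt_eqF // cis_nat subrr.
rewrite subrX1 => /eqP; rewrite mulf_eq0 subr_eq0 => /orP[|/eqP//].
have kM1 : 0 < (k%:R / M%:R : R) < 1.
  apply/andP; split; first by rewrite divr_gt0 // ltr0n.
  by rewrite ltr_pdivrMr // mul1r ltr_nat.
by rewrite (negbTE (cis_neq1 _ kM1)).
Qed.

Lemma sum_cis_grid (M : nat) (w : int) : (`|w| < M)%N ->
  \sum_(m < M) cis (w%:~R * (m%:R / M%:R)) = M%:R *+ (w == 0).
Proof.
case: w => [[|k]|k] hM.
- under eq_bigr do rewrite mul0r cis0.
  by rewrite sumr_const card_ord mulr1n.
- by rewrite mulr0n; exact: sum_cis_grid_nat.
(* Conjugation turns a negative frequency into a positive one. *)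
rewrite mulr0n; apply: (can_inj (@complex.conjcK R)).
rewrite rmorph0 rmorph_sum.
rewrite -[RHS](@sum_cis_grid_nat M k.+1) //; apply: eq_bigr => m _.
by apply: etrans (cis_conj _) _; rewrite -mulNr NegzE mulrNz opprK.
Qed.

Local Notation "x %:C" :=
  (complex.real_complex R x) (at level 2, format "x %:C").

Definition sqnormc (z : R[i]) : R := complex.Re z ^+ 2 + complex.Im z ^+ 2.

Lemma sqnormcE (z : R[i]) : (sqnormc z)%:C = z * complex.conjc z.
Proof. by rewrite complex.add_Re2_Im2 complex.sqr_normc. Qed.

Definition weighted_cis (p : nat -> R) (s : nat) t : R[i] :=
  \sum_(j < s.*2.+1) (p j)%:C * cis ((j%:Z - s%:Z)%:~R * t).

Lemma sqnormc_weighted_cis p s t : (sqnormc (weighted_cis p s t))%:C =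
  \sum_(j < s.*2.+1) \sum_(l < s.*2.+1)
     (p j * p l)%:C * cis ((j%:Z - l%:Z)%:~R * t).
Proof.
rewrite sqnormcE {2}/weighted_cis rmorph_sum /weighted_cis mulr_suml.
apply: eq_bigr => j _; rewrite mulr_sumr; apply: eq_bigr => l _.
rewrite rmorphM [X in _ * (X * _)]complex.conjc_real.
rewrite [X in _ * (_ * X)]cis_conj rmorphM mulrACA -cisD.
by congr (_ * cis _); rewrite !intrB; ring.
Qed.

(** The pair [(j, l)] leaves frequency [w - (j - l)] on the grid, of size at most [2 s + |w| < M].
    There is thus no aliasing, and only the pairs with [j - l = w] survive. *)
Lemma grid_convolution p s (M : nat) (w : int) (x : R) : p 0 = 0 ->
  (s.*2 + `|w| < M)%N ->
  \sum_(m < M) (sqnormc (weighted_cis p s (x - m%:R / M%:R)))%:C *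
     cis (w%:~R * (m%:R / M%:R)) =
  (M%:R * autocorr p s.*2.+1 `|w|)%:C * cis (w%:~R * x).
Proof.
move=> p0 hM; rewrite -autocorr_pairs //.
under eq_bigr do rewrite sqnormc_weighted_cis mulr_suml.
rewrite exchange_big /= rmorphM rmorph_sum mulr_sumr mulr_suml.
apply: eq_bigr => j _.
under eq_bigr do rewrite mulr_suml.
rewrite exchange_big /= rmorph_sum mulr_sumr mulr_suml.
apply: eq_bigr => l _.
under eq_bigr do rewrite -mulrA -cisD.
rewrite -mulr_sumr.
have -> : \sum_(m < M) cis ((j%:Z - l%:Z)%:~R * (x - m%:R / M%:R) +
    w%:~R * (m%:R / M%:R)) = cis ((j%:Z - l%:Z)%:~R * x) *
   \sum_(m < M) cis ((w - (j%:Z - l%:Z))%:~R * (m%:R / M%:R)).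
  rewrite mulr_sumr; apply: eq_bigr => m _; rewrite -cisD; congr cis.
  by rewrite !intrB; ring.
rewrite sum_cis_grid; last first.
  by have := ltn_ord j; have := ltn_ord l; lia.
rewrite subr_eq0 [w == _]eq_sym; case: eqP => [->|_].
  by rewrite !mulr1n rmorph_nat; ring.
by rewrite !mulr0n rmorph0 !(mulr0, mul0r).
Qed.

End Cis.

(** * Quadrature on a regular grid *)

Section Grid.
Context {R : realType} {d : nat}.
Implicit Types (x : 'I_d -> R) (p : nat -> R).

Local Notation "x %:C" :=
  (complex.real_complex R x) (at level 2, format "x %:C").

Lemma echarE n (k : freq d n) x :
  echar k x = \prod_i cis ((fval k i)%:~R * x i).
Proof. by rewrite -cis_sum. Qed.

Lemma echar_freq0 n x : echar (freq0 d n) x = 1.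
Proof.
rewrite echarE big1 // => i _.
by rewrite /fval /freq0 ffunE inordK ?subrr ?mul0r ?cis0 //; lia.
Qed.

Lemma fval_le n (k : freq d n) i : (`|fval k i| <= n)%N.
Proof. by rewrite /fval; have := ltn_ord (k i); lia. Qed.

Definition grid_point M (g : {ffun 'I_d -> 'I_M}) (i : 'I_d) : R :=
  (g i)%:R / M%:R.

Lemma grid_point_cube M (g : {ffun 'I_d -> 'I_M}) : cube R d (grid_point M g).
Proof.
move=> i; have M0 : (0 < M)%N by have := ltn_ord (g i); lia.
rewrite /grid_point divr_ge0 ?ler0n //= ler_pdivrMr ?ltr0n // mul1r ler_nat.
exact: ltnW.
Qed.

Definition multiplier p s n (k : freq d n) : R :=
  \prod_i (autocorr p s.*2.+1 `|fval k i| / autocorr p s.*2.+1 0).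

(** This is the kernel [K] centred at the grid point, times the quadrature weight [M^-d]. *)
Definition grid_weight p s M (g : {ffun 'I_d -> 'I_M}) x : R :=
  \prod_i (sqnormc (weighted_cis p s (x i - grid_point M g i)) /
           (M%:R * autocorr p s.*2.+1 0)).

Lemma grid_weight_echar p s n M (k : freq d n) x : p 0 = 0 ->
  autocorr p s.*2.+1 0 != 0 -> (s.*2 + n < M)%N ->
  \sum_g (grid_weight p s M g x)%:C * echar k (grid_point M g) =
  (multiplier p s n k)%:C * echar k x.
Proof.
move=> p0 + hM; rewrite echarE /multiplier rmorph_prod -big_split /=.
rewrite /grid_weight; move: (autocorr p s.*2.+1 0) => S S0.
have M0 : M%:R != 0 :> R by rewrite pnatr_eq0; lia.
under eq_bigr => g _ do rewrite echarE rmorph_prod -big_split /=.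
(* The sum over the product grid factors into one-variable sums. *)
rewrite -(bigA_distr_bigA (fun i (m : 'I_M) =>
   (sqnormc (weighted_cis p s (x i - m%:R / M%:R)) / (M%:R * S))%:C *
   cis ((fval k i)%:~R * (m%:R / M%:R)))) /=.
apply: eq_bigr => i _.
transitivity ((M%:R * S)^-1%:C * \sum_(m < M)
   (sqnormc (weighted_cis p s (x i - m%:R / M%:R)))%:C *
   cis ((fval k i)%:~R * (m%:R / M%:R))).
  rewrite mulr_sumr; apply: eq_bigr => m _.
  by rewrite mulrA -rmorphM; congr (_%:C * _); exact: mulrC.
rewrite grid_convolution // ?mulrA -?rmorphM; last first.
  by have := fval_le n k i; lia.
congr (_%:C * _); field; by rewrite M0 S0.
Qed.

Lemma multiplier_freq0 p s n : autocorr p s.*2.+1 0 != 0 ->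
  multiplier p s n (freq0 d n) = 1.
Proof.
move=> S0; rewrite /multiplier big1 // => i _.
rewrite /fval /freq0 ffunE inordK ?subrr ?divff //; lia.
Qed.

Lemma sum_grid_weight p s M x : p 0 = 0 ->
  autocorr p s.*2.+1 0 != 0 -> (s.*2 < M)%N ->
  \sum_g grid_weight p s M g x = 1.
Proof.
move=> p0 S0 hM; apply: (@complex.complexI R).
(* With [n = 0] the only frequency is zero, so [M > 2 s] is enough. *)
have := grid_weight_echar p s 0 M (freq0 d 0) x p0 S0.
rewrite addn0 multiplier_freq0 // echar_freq0 mulr1 => /(_ hM) <-.
rewrite rmorph_sum; apply: eq_bigr => g _; by rewrite echar_freq0 mulr1.
Qed.

(** The phases translate the product polynomial to the grid point; its degree stays [s]. *)
Definition grid_square p s M (g : {ffun 'I_d -> 'I_M}) (c : R)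
    (k : freq d s) : R[i] :=
  c%:C * \prod_i ((p (k i))%:C * cis (- ((fval k i)%:~R * grid_point M g i))).

Lemma trigpol_grid_square p s M g c x :
  trigpol (grid_square p s M g c) x =
  c%:C * \prod_i weighted_cis p s (x i - grid_point M g i).
Proof.
rewrite /trigpol /weighted_cis bigA_distr_bigA mulr_sumr.
apply: eq_bigr => k _; rewrite echarE /grid_square -mulrA -big_split /=.
congr (_ * _); apply: eq_bigr => i _; rewrite -mulrA -cisD.
congr (_ * cis _); rewrite /fval; ring.
Qed.

Lemma sqnormcM (z w : R[i]) : sqnormc (z * w) = sqnormc z * sqnormc w.
Proof. by case: z w => [a b] [c e]; rewrite /sqnormc /=; ring. Qed.

Lemma sqnormc_prod (I : finType) (F : I -> R[i]) :
  sqnormc (\prod_i F i) = \prod_i sqnormc (F i).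
Proof.
by apply: big_morph; [exact: sqnormcM|rewrite /sqnormc /= expr1n expr0n addr0].
Qed.

Lemma norm_grid_square p s M g (c : R) x : 0 <= c ->
  0 < M%:R * autocorr p s.*2.+1 0 ->
  `|trigpol (grid_square p s M g
      (Num.sqrt (c / (M%:R * autocorr p s.*2.+1 0) ^+ d))) x| ^+ 2 =
  (grid_weight p s M g x * c)%:C.
Proof.
move=> c0 S0; rewrite -complex.add_Re2_Im2; congr (_%:C).
rewrite trigpol_grid_square -/(sqnormc _) sqnormcM sqnormc_prod.
rewrite {1}/sqnormc /= expr0n addr0 sqr_sqrtr; last first.
  by rewrite divr_ge0 // exprn_ge0 // ltW.
rewrite /grid_weight big_split /= prodr_const card_ord exprVn; ring.
Qed.

End Grid.

(** * Sums of squares *)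

Section Sos.
Context {R : realType} {d : nat}.
Implicit Types (x : 'I_d -> R) (p : nat -> R).

Local Notation "x %:C" :=
  (complex.real_complex R x) (at level 2, format "x %:C").

Lemma ReD (z w : R[i]) : complex.Re (z + w) = complex.Re z + complex.Re w.
Proof. by case: z w => [? ?] []. Qed.

Lemma Re_sum (I : finType) (F : I -> R[i]) :
  complex.Re (\sum_i F i) = \sum_i complex.Re (F i).
Proof. exact: (big_morph _ ReD erefl). Qed.

Lemma ReMreal (c : R) (z : R[i]) : complex.Re (c%:C * z) = c * complex.Re z.
Proof. by case: z => a b; rewrite /= mul0r subr0. Qed.

Lemma Re_geNnormc (z : R[i]) : - cmod z <= complex.Re z.
Proof.
case: z => a b /=; rewrite lerNl; apply: le_trans (ler_norm _) _.
by rewrite normrN -sqrtr_sqr ler_wsqrtr // lerDl sqr_ge0.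
Qed.

Lemma cmod_real (c : R) : cmod c%:C = `|c|.
Proof. by rewrite /= expr0n addr0 sqrtr_sqr. Qed.

Lemma cmod_echar n (k : freq d n) x : cmod (echar k x) = 1.
Proof. by rewrite /echar /= cos2Dsin2 sqrtr1. Qed.

Lemma Re_trigpol_ge n (a : freq d n -> R[i]) x :
  - \sum_k cmod (a k) <= complex.Re (trigpol a x).
Proof.
rewrite /trigpol Re_sum -sumrN; apply: ler_sum => k _.
by apply: le_trans (Re_geNnormc _); rewrite Normc.normcM cmod_echar mulr1.
Qed.

Lemma fstar_le n (a : freq d n -> R[i]) x : cube R d x ->
  fstar a <= complex.Re (trigpol a x).
Proof.
move=> xc; apply: ge_inf; last by exists x.
(* [inf] is only meaningful once the set of values has a lower bound. *)
by exists (- \sum_k cmod (a k)) => _ [y _ <-]; exact: Re_trigpol_ge.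
Qed.

Lemma sos_bounds_le_fstar n s (a : freq d n -> R[i]) c :
  sos_bounds a s c -> c <= fstar a.
Proof.
move=> [N [b hb]]; apply: lb_le_inf.
  exists (complex.Re (trigpol a (fun=> 0))), (fun=> 0) => // i.
  by rewrite lexx ler01.
move=> _ [x xc <-]; rewrite -subr_ge0.
(* The order on [R[i]] asks for equal imaginary parts and ordered real parts. *)
have : 0 <= trigpol a x - c%:C.
  by rewrite (hb x xc); apply: sumr_ge0 => j _; rewrite exprn_ge0.
by rewrite complex.lecE => /andP[_]; rewrite ReD.
Qed.

Definition deconvolve p s n (a : freq d n -> R[i]) : freq d n -> R[i] :=
  fun k => a k * ((multiplier p s n k)^-1)%:C.

Lemma trigpol_grid p s n M (a : freq d n -> R[i]) x : p 0 = 0 ->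
  autocorr p s.*2.+1 0 != 0 -> (s.*2 + n < M)%N ->
  (forall k : freq d n, multiplier p s n k != 0) ->
  trigpol a x = \sum_g (grid_weight p s M g x)%:C *
                   trigpol (deconvolve p s n a) (grid_point M g).
Proof.
move=> p0 S0 hM lam0; rewrite /trigpol.
under [RHS]eq_bigr do rewrite mulr_sumr.
rewrite exchange_big /=; apply: eq_bigr => k _.
under eq_bigr do rewrite mulrCA.
rewrite -mulr_sumr grid_weight_echar // mulrA /deconvolve -[a k * _ * _]mulrA.
by rewrite -rmorphM mulVf // rmorph1 mulr1.
Qed.

Lemma sos_bounds_grid p s n M (a : freq d n -> R[i]) c : p 0 = 0 ->
  0 < autocorr p s.*2.+1 0 -> (s.*2 + n < M)%N ->
  (forall k : freq d n, multiplier p s n k != 0) ->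
  (forall x, complex.Im (trigpol a x) = 0) ->
  (forall y, cube R d y -> c <= complex.Re (trigpol (deconvolve p s n a) y)) ->
  sos_bounds a s c.
Proof.
move=> p0 S0 hM lam0 areal hc; set h := trigpol (deconvolve p s n a) in hc.
have S1 := lt0r_neq0 S0.
have MS : 0 < M%:R * autocorr p s.*2.+1 0 by rewrite mulr_gt0 // ltr0n; lia.
pose G : finType := {ffun 'I_d -> 'I_M}.
(* There is one square per grid point; the square root absorbs the nonnegative value of [Re h - c]
   there and the normalisation of the weight. *)
pose b (g : G) := grid_square p s M g (Num.sqrt
  ((complex.Re (h (grid_point M g)) - c) / (M%:R * autocorr p s.*2.+1 0) ^+ d)).
exists #|G|, (fun j => b (enum_val j)) => x _.
rewrite -(big_enum_val (fun g => `|trigpol (b g) x| ^+ 2)) /=.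
have hc0 g : 0 <= complex.Re (h (grid_point M g)) - c.
  by rewrite subr_ge0; apply: hc; exact: grid_point_cube.
rewrite (eq_bigr (fun g => (grid_weight p s M g x *
  (complex.Re (h (grid_point M g)) - c))%:C)); last first.
  by move=> g _; exact: norm_grid_square.
rewrite -rmorph_sum.
have -> : trigpol a x = (complex.Re (trigpol a x))%:C.
  by have := areal x; case: (trigpol a x) => u v /= ->.
rewrite -[complex.Complex c 0]/(c%:C) -rmorphB; congr (_%:C).
under eq_bigr do rewrite mulrBr.
rewrite sumrB -mulr_suml sum_grid_weight //; last by lia.
rewrite mul1r (trigpol_grid p s n M) // Re_sum; congr (_ - _).
by apply: eq_bigr => g _; rewrite ReMreal.
Qed.

(** The zero frequency cancels, its multiplier being 1. Any other coefficient changes by the factor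
    [1 / lam - 1], which lies between 0 and [1 / L - 1]. *)
Lemma Re_deconvolve_ge p s n (a : freq d n -> R[i]) (L : R) x :
  autocorr p s.*2.+1 0 != 0 -> 0 < L ->
  (forall k : freq d n, L <= multiplier p s n k <= 1) ->
  complex.Re (trigpol a x) - Fnorm_centered a * (L^-1 - 1) <=
  complex.Re (trigpol (deconvolve p s n a) x).
Proof.
move=> S0 L0 lamL; rewrite lerBlDr -lerBlDl.
rewrite /trigpol !Re_sum -sumrB (bigD1 (freq0 d n)) //=.
rewrite {1}/deconvolve multiplier_freq0 // invr1 rmorph1 mulr1 subrr add0r.
rewrite /Fnorm_centered mulr_suml; apply: ler_sum => k _.
have /andP[Lk k1] := lamL k.
have k0 : 0 < multiplier p s n k by apply: lt_le_trans Lk.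
rewrite lerBlDl -lerBlDr.
have -> : complex.Re (deconvolve p s n a k * echar k x) =
  complex.Re (a k * echar k x) +
  complex.Re (((multiplier p s n k)^-1 - 1)%:C * (a k * echar k x)).
  rewrite -ReD; congr complex.Re; rewrite /deconvolve rmorphB rmorph1; ring.
rewrite lerD2l; apply: le_trans (Re_geNnormc _); rewrite lerN2.
rewrite !Normc.normcM cmod_echar mulr1 cmod_real ger0_norm; last first.
  by rewrite subr_ge0 invf_ge1.
rewrite mulrC; apply: ler_wpM2l; first by case: (a k) => ? ?; exact: sqrtr_ge0.
by rewrite lerD2r lef_pV2.
Qed.

Lemma tent_multiplier s r (k : freq d r.*2) : (3 * r <= s)%N -> (0 < s)%N ->
  (1 - 6 * r%:R ^+ 2 / s%:R ^+ 2) ^+ d <=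
  (multiplier (tent s) s r.*2 k : R) <= 1.
Proof.
move=> rs s0; have sR : 0 < s%:R :> R by rewrite ltr0n.
have S0 := tent_norm_gt0 (R := R) s s0.
(* From [3 r <= s] the quotient is at most 2/3; nonnegativity is what allows the bounds on the
   factors to be multiplied. *)
have L0 : 0 <= 1 - 6 * r%:R ^+ 2 / s%:R ^+ 2 :> R.
  rewrite subr_ge0 ler_pdivrMr ?exprn_gt0 // mul1r.
  have : 3 * r%:R <= s%:R :> R by rewrite -natrM ler_nat.
  have : 0 <= r%:R :> R by []. nra.
have fac i : 1 - 6 * r%:R ^+ 2 / s%:R ^+ 2 <=
    (autocorr (tent s) s.*2.+1 `|fval k i| /
     autocorr (tent s) s.*2.+1 0 : R) <= 1.
  apply/andP; split; last first.
    rewrite ler_pdivrMr // mul1r; apply: autocorr_le; first exact: tent0.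
    exact: tent_out.
  apply: le_trans (tent_autocorr_ge _ _ s0); rewrite lerD2l lerN2.
  have -> : 6 * r%:R ^+ 2 / s%:R ^+ 2 =
      3 * (r.*2%:R) ^+ 2 / (2 * s%:R ^+ 2) :> R.
    by rewrite -mul2n natrM; field; rewrite gt_eqF.
  rewrite ler_pM2r ?invr_gt0 ?mulr_gt0 ?exprn_gt0 // ler_pM2l //.
  by rewrite ler_sqr ?nnegrE ?ler0n // ler_nat fval_le.
apply/andP; split.
  rewrite -[X in _ ^+ X]card_ord -prodr_const.
  by apply: ler_prod => i _; rewrite L0; have /andP[] := fac i.
by apply: prodr_ile1 => i _; have /andP[h ->] := fac i; rewrite (le_trans L0 h).
Qed.

End Sos.

(** * Asymptotics of the bound *)

(** With [u = A / s^2] and [v = 1 / (1 - u)], one has [v - 1 = u v], so the geometric sum gives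
    [v^d - 1 = u P(v)] with [P = X + ... + X^d]. As [v] tends to 1, [P(v)] tends to [d]. *)
Lemma onem_inv_expB1_equiv (R : realType) (A F : R) (d : nat) : (0 < d)%N ->
  (fun s : nat => F * ((1 - A / s%:R ^+ 2) ^- d - 1))
    ~_(\oo) (fun s : nat => F * (A * d%:R / s%:R ^+ 2)).
Proof.
move=> d0; have dR : 0 < d%:R :> R by rewrite ltr0n.
pose u (s : nat) : R := A / s%:R ^+ 2.
pose P : {poly R} := \sum_(i < d) 'X^(i.+1).
have P1 : P.[1] = d%:R.
  rewrite /P horner_sum; under eq_bigr do rewrite hornerXn expr1n.
  by rewrite sumr_const card_ord.
have id_oo : (fun s : nat => s%:R : R) @ \oo --> +oo by exact: cvgr_idn.
have inv0 : (fun s : nat => (s%:R)^-1 : R) @ \oo --> (0 : R).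
  apply/gtr0_cvgV0 => //.
  by exists 1%N => // s /= s0; rewrite ltr0n.
have u0 : u @ \oo --> (0 : R).
  rewrite -[X in _ --> X](mulr0 (A * 0)).
  rewrite (_ : u = (fun s => A * (s%:R)^-1 * (s%:R)^-1)); last first.
    by apply/funext => s; rewrite /u expr2 invfM mulrA.
  by apply: cvgM => //; apply: cvgM => //; exact: cvg_cst.
have v1 : (fun s => (1 - u s)^-1) @ \oo --> (1 : R).
  rewrite -[X in _ --> X]invr1; apply: cvgV; first exact: oner_neq0.
  rewrite -[X in _ --> X]subr0; apply: cvgB => //; exact: cvg_cst.
have Pv : (fun s => P.[(1 - u s)^-1]) @ \oo --> (d%:R : R).
  rewrite -P1; apply: (cvg_comp _ _ v1); exact: continuous_horner.
apply/eqaddoP => e e0.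
have ed : 0 < e * d%:R by rewrite mulr_gt0.
near=> s.
have u1 : u s < 1.
  near: s; apply: (cvgr_lt _ u0); exact: ltr01.
have Pd : `|d%:R - P.[(1 - u s)^-1]| <= e * d%:R.
  by near: s; exact: (cvgr_dist_le _ _ Pv).
set v := (1 - u s)^-1 in Pd.
have v0 : 1 - u s != 0 by rewrite subr_eq0 eq_sym lt_eqF.
have uv : v - 1 = u s * v.
  by rewrite /v; field.
have main : (1 - u s) ^- d - 1 = u s * P.[v].
  rewrite -exprVn -/v subrX1 uv -mulrA; congr (_ * _).
  rewrite /P horner_sum mulr_sumr; apply: eq_bigr => i _.
  by rewrite hornerXn exprS.
suff : `|F * ((1 - u s) ^- d - 1) - F * (A * d%:R / s%:R ^+ 2)|
    <= e * `|F * (A * d%:R / s%:R ^+ 2)| by [].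
rewrite main.
have -> : A * d%:R / s%:R ^+ 2 = u s * d%:R by rewrite /u mulrAC.
have -> : F * (u s * P.[v]) - F * (u s * d%:R) =
    F * u s * (P.[v] - d%:R) by ring.
rewrite [F * (u s * _)]mulrA 2!(normrM (F * u s)) distrC [`|d%:R|]gtr0_norm //.
by rewrite [leRHS]mulrCA; apply: ler_wpM2l.
Unshelve. all: by end_near.
Qed.

Theorem theorem1 (R : realType) (d r : nat) (hd : (1 <= d)%N) (hr : (1 <= r)%N)
  (a : freq d (r.*2) -> R[i])
  (hreal : forall x : 'I_d -> R, complex.Im (trigpol a x) = 0) :
  (forall s : nat, (3 * r <= s)%N ->
     (0 <= (fstar a)%:E - cstar a s <= (sos_bound r s a)%:E)%E)
  /\
  ((fun s : nat => sos_bound r s a)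
     ~_(\oo) (fun s : nat => Fnorm_centered a * (6 * (r%:R) ^+ 2 * d%:R / (s%:R) ^+ 2))).
Proof.
split=> [s rs|]; last exact: onem_inv_expB1_equiv.
have s0 : (0 < s)%N by lia.
have sR : 0 < s%:R :> R by rewrite ltr0n.
have S0 := tent_norm_gt0 (R := R) s s0.
pose L : R := (1 - 6 * r%:R ^+ 2 / s%:R ^+ 2) ^+ d.
have L0 : 0 < L.
  rewrite exprn_gt0 // subr_gt0 ltr_pdivrMr ?exprn_gt0 // mul1r.
  have : 3 * r%:R <= s%:R :> R by rewrite -natrM ler_nat.
  have : 0 < r%:R :> R by rewrite ltr0n.
  nra.
have lamL (k : freq d r.*2) : L <= (multiplier (tent s) s r.*2 k : R) <= 1.
  exact: tent_multiplier.
have upper : (cstar a s <= (fstar a)%:E)%E.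
  by apply: ge_ereal_sup => _ [c hc <-]; rewrite lee_fin;
     exact: sos_bounds_le_fstar hc.
have lower : ((fstar a - sos_bound r s a)%:E <= cstar a s)%E.
  apply: ereal_sup_ubound; exists (fstar a - sos_bound r s a) => //.
  (* This is the smallest grid free of aliasing for kernel degree [2 s] and frequencies up to
     [2 r]. *)
  apply: (sos_bounds_grid (tent s) s r.*2 (s.*2 + r.*2).+1) => //.
  - exact: tent0.
  - move=> k; have /andP[h _] := lamL k.
    by rewrite gt_eqF // (lt_le_trans L0 h).
  move=> y yc.
  apply: le_trans (Re_deconvolve_ge (tent s) s r.*2 a L y _ L0 lamL).
    by rewrite lerD2r fstar_le.
  by rewrite gt_eqF.
(* Being squeezed between two reals, [cstar a s] is finite, and the extended subtraction becomes a
   real one. *)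
have [c hc] : exists c : R, cstar a s = c%:E.
  exists (fine (cstar a s)); rewrite fineK // fin_numE.
  by move: upper lower; case: (cstar a s).
move: upper lower; rewrite hc !lee_fin => upper lower.
by apply/andP; split; lra.
Qed.
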